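(* Let $n>1$ be a positive integer with $\gcd(n,6)=1$, let $k$ be a positive integer and let $v$ be a positive odd integer. Then $$\prod_{d\mid n}\binom{kd+[vd/2]}{(vd-1)/2}^{\mu(n/d)}\equiv 4^{-k\phi(n)}+\frac{k(7v^2+14kv+8k^2)}{4}\,n^3\,\frac{B_{\phi(n)-2,\chi_n}}{\phi(n)-2}\pmod{n^4}.$$
   Context: $[x]$ denotes the integer part of $x$, $\mu$ is the Möbius function and $\phi$ is Euler's totient function. $B_s$ denotes the $s$-th Bernoulli number, and for the trivial Dirichlet character $\chi_n$ modulo $n$ the generalized Bernoulli numbers are $B_{s,\chi_n}=B_s\prod_{p\mid n}(1-p^{s-1})$ (product over primes dividing $n$). For rational numbers $a,b$ and a positive integer $N$, $a\equiv b\pmod N$ means that $(a-b)/N$ is a rational number whose denominator is coprime to $N$. *)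

(* Defs.v *)
From mathcomp Require Import all_boot all_order all_algebra.
Set Implicit Arguments.
Unset Strict Implicit.
Unset Printing Implicit Defensive.
Import Order.TTheory GRing.Theory Num.Theory.
Local Open Scope ring_scope.

Definition moebius (n : nat) : int :=
  if (0 < n)%N && all (fun p => ~~ (p ^ 2 %| n)%N) (primes n)
  then (-1) ^+ size (primes n) else 0.

(* [:: B_0; ...; B_(m-1)], each entry being obtained from the previous ones by
   B_m = [m = 0] - (m+1)^-1 * \sum_(j < m) 'C(m+1, j) * B_j (so B_1 = -1/2). *)
Fixpoint bernoulli_seq (m : nat) : seq rat :=
  if m is m'.+1 then
    let s := bernoulli_seq m' in
    rcons s ((m' == 0%N)%:R
             - (\sum_(j < m') 'C(m'.+1, j)%:R * s`_j) / m'.+1%:R)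
  else [::].

Definition bernoulli (m : nat) : rat := (bernoulli_seq m.+1)`_m.

Lemma size_bernoulli_seq m : size (bernoulli_seq m) = m.
Proof. by elim: m => //= m IH; rewrite size_rcons IH. Qed.

Lemma nth_bernoulli_seq m j : (j < m)%N -> (bernoulli_seq m)`_j = bernoulli j.
Proof.
elim: m => // m IH; rewrite ltnS leq_eqVlt => /orP[/eqP -> //|jm].
by rewrite /= nth_rcons size_bernoulli_seq jm IH.
Qed.

Lemma sum_bernoulli m :
  \sum_(j < m.+1) 'C(m.+1, j)%:R * bernoulli j = (m == 0%N)%:R.
Proof.
rewrite big_ord_recr /= [X in _ * X]/bernoulli /= nth_rcons size_bernoulli_seq.
rewrite ltnn eqxx binSn mulrBr mulrCA divff ?pnatr_eq0 // mulr1.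
under [X in _ - X]eq_bigr => j _ do rewrite nth_bernoulli_seq //.
by rewrite addrC subrK; case: m => //= m; rewrite mulr0.
Qed.

(* B_{s, chi_n} for the trivial character chi_n modulo n; the exponent s - 1 is
   taken in int so that s = 0 gives p^-1. *)
Definition bernoulli_triv (s n : nat) : rat :=
  bernoulli s * \prod_(p <- primes n) (1 - p%:R ^ (s%:Z - 1)).

Definition ratcong (N : nat) (a b : rat) : Prop :=
  coprimez (denq ((a - b) / N%:R)) N%:Z.

(* Main.v *)
From HB Require Import structures.
Require Import Defs.
From mathcomp Require Import all_boot all_order all_algebra.
From mathcomp Require Import cyclic.
From mathcomp Require Import ring zify.
Set Implicit Arguments.
Unset Strict Implicit.
Unset Printing Implicit Defensive.
Import Order.TTheory GRing.Theory Num.Theory.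
Local Open Scope ring_scope.

(* Moebius inversion turns the left-hand side into the product P(k) of (k n + a) / a over
   0 < a < v n / 2 prime to n.  Put h = (n - 1) / 2 and let j range over the integers in [1, h]
   prime to n.  With v = 2 u + 1, the quotient P(k + 1) / P(k) is a product of the integers
   prime to n in a block of length n centred at (u + k + 1) n, divided by the one over
   [k n, (k + 1) n].  Pairing x with its reflection in each block, and comparing the
   decompositions {j, n - j} and {2 j, n - 2 j} of the residues prime to n, gives
     4^phi(n) P(k + 1) / P(k) = \prod_j (1 + n^2 x_j)
   with x_j explicit, so that modulo n^4 only \sum_j x_j modulo n^2 matters.  That sum is a
   combination of H2 = \sum_j j^-2 and E = \sum_j 1 / (j (n - j)).

   The same two decompositions, applied to \sum i^-2 and to \sum i^s with s = phi(n) - 2,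
   express H2, E and beta = B_{s, chi_n} / s through \sum_j j^-3:
     beta = H3 / 6 (mod n),  H2 = - 7 n beta (mod n^2),  E = n beta (mod n^2);
   the factor 2^s - 1 appearing there is prime to n because gcd (n, 6) = 1, and the power sum
   \sum i^s is n B_{s, chi_n} modulo s n^2 by Faulhaber's formula. *)

(** * The localization of Z at the primes dividing n *)

(** [ratcong N a b] asks that [(a - b) / N%:R] lie in [zloc N]. As [n ^ 4] and [n] have the same
    prime factors, everything can be done in [zloc n]. *)
Definition zloc (n : nat) : {pred rat} := [pred x | coprimez (denq x) n%:Z].

(** The reduced denominator divides any [d] that clears [x], so no fraction has to be reduced when
    checking closure under sums and products. *)
Lemma zlocP (n : nat) (x : rat) :
  reflect (exists2 d : nat, (0 < d)%N && coprime n d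
           & x * d%:R \is a Num.int) (x \in zloc n).
Proof.
apply: (iffP idP) => [|[d /andP[d0 cd] /intrP[m xm]]].
  rewrite inE /coprimez /= => cx; exists `|denq x|%N.
    by rewrite absz_gt0 denq_eq0 coprime_sym.
  rewrite -[X in X * _]divq_num_den natr_absz gtr0_norm ?denq_gt0 //.
  by rewrite divfK ?intr_eq0 ?denq_eq0.
have e : numq x * d%:Z = m * denq x.
  apply: (@intr_inj rat); rewrite !intrM -xm /= numqE; ring.
have dv : (denq x %| d%:Z)%Z.
  rewrite -(Gauss_dvdzr _ (n := numq x)) ?e ?dvdz_mull //.
  by rewrite coprimezE coprime_sym coprime_num_den.
by rewrite inE coprimezE; apply: coprime_dvdl dv _; rewrite coprime_sym.
Qed.

Fact zloc_subring (n : nat) : subring_closed (zloc n).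
Proof.
split.
- by apply/zlocP; exists 1%N; rewrite ?coprimen1 // mulr1.
- move=> x y /zlocP[d /andP[d0 cd] xd] /zlocP[e /andP[e0 ce] ye].
  apply/zlocP; exists (d * e)%N; first by rewrite muln_gt0 d0 e0 coprimeMr cd ce.
  have -> : (x - y) * (d * e)%:R = x * d%:R * e%:R - y * e%:R * d%:R :> rat.
    by rewrite natrM; ring.
  by rewrite rpredB // rpredM // rpred_nat.
- move=> x y /zlocP[d /andP[d0 cd] xd] /zlocP[e /andP[e0 ce] ye].
  apply/zlocP; exists (d * e)%N; first by rewrite muln_gt0 d0 e0 coprimeMr cd ce.
  have -> : (x * y) * (d * e)%:R = x * d%:R * (y * e%:R) :> rat by rewrite natrM; ring.
  by rewrite rpredM.
Qed.

HB.instance Definition _ n := GRing.isSubringClosed.Build rat (zloc n) (zloc_subring n).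

Lemma zlocV (n a : nat) : coprime n a -> a%:R^-1 \in zloc n.
Proof.
case: a => [|a] ca; first by rewrite invr0 rpred0.
by apply/zlocP; exists a.+1; rewrite // mulVf // pnatr_eq0.
Qed.

(** As gcd(n, 6) = 1, a nontrivial common divisor of n and m is at least 5. Each factor n cancels
    gcd(n, m) from m until m is prime to n, and m < 5^(t+1) leaves room for at most t
    cancellations. *)
Lemma zloc_expn_div (n t m : nat) :
  gcdn n 6 = 1%N -> (0 < m < 5 ^ t.+1)%N -> n%:R ^+ t / m%:R \in zloc n.
Proof.
move=> n6.
have g5 m' : (0 < m')%N -> ~~ coprime n m' -> (5 <= gcdn n m')%N.
  move=> m0; rewrite /coprime; set g := gcdn n m' => g1.
  have g6 : coprime g 6.
    by apply: (@coprime_dvdl _ n); rewrite ?dvdn_gcdl // /coprime n6.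
  have : (0 < g)%N by rewrite gcdn_gt0 m0 orbT.
  by move: g6 g1; case: (g) => [|[|[|[|[|]]]]].
elim: t m => [|t IH] m /andP[m0 mt]; (have [cnm|cnm] := boolP (coprime n m);
  first by rewrite rpredM ?rpredX ?rpred_nat ?zlocV);
  have := g5 _ m0 cnm; set g := gcdn n m => g_ge5.
  have := dvdn_leq m0 (dvdn_gcdr n m); rewrite -/g => gm.
  by rewrite expn1 in mt; lia.
have [m' em] : exists m', m = (m' * g)%N by apply/dvdnP/dvdn_gcdr.
have [n' en] : exists n', n = (n' * g)%N by apply/dvdnP/dvdn_gcdl.
have m'0 : (0 < m')%N by clear -em m0; nia.
have -> : n%:R ^+ t.+1 / m%:R = n'%:R * (n%:R ^+ t / m'%:R) :> rat.
  have gn0 : g%:R != 0 :> rat by rewrite pnatr_eq0 -lt0n; lia.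
  have mn0 : m'%:R != 0 :> rat by rewrite pnatr_eq0 -lt0n.
  rewrite exprS; move: (n%:R ^+ t) => y; rewrite em en !natrM.
  by field; rewrite gn0 mn0.
rewrite rpredM ?rpred_nat // IH // m'0 /=.
move: mt; rewrite em [X in (_ < X)%N]expnS; clear -g_ge5.
by move: (5 ^ t.+1)%N => z; nia.
Qed.

(** * Moebius inversion *)

Lemma moebius_mul_prime (p d : nat) :
  prime p -> (0 < d)%N -> moebius (p * d) = if (p %| d)%N then 0 else - moebius d.
Proof.
move=> pp d0; rewrite /moebius muln_gt0 prime_gt0 // d0 /=.
have [pd|pd] := boolP (p %| d)%N.
  rewrite ifF //; apply/negbTE/allPn; exists p.
    by rewrite mem_primes pp muln_gt0 prime_gt0 // d0 dvdn_mulr.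
  by rewrite negbK expnS dvdn_mul ?expn1.
have pr : perm_eq (primes (p * d)) (p :: primes d).
  apply: uniq_perm; rewrite /= ?primes_uniq ?andbT //.
    by rewrite mem_primes pp d0.
  by move=> q; rewrite primesM ?(prime_gt0 pp) // primes_prime // !inE.
rewrite (perm_all _ pr) (perm_size pr) /=.
have -> : (p ^ 2 %| p * d)%N = false.
  by rewrite expnS expn1 dvdn_pmul2l ?prime_gt0 ?(negbTE pd).
rewrite /= (eq_in_all (a2 := fun q => ~~ (q ^ 2 %| d)%N)) => [|q].
  by case: ifP; rewrite ?oppr0 // exprS mulN1r.
rewrite mem_primes => /and3P[pq _ qd]; rewrite Gauss_dvdr // coprimeXl //.
rewrite prime_coprime // dvdn_prime2 //; apply: contraNneq pd => <-.
by [].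
Qed.

(** For m > 1 let p be its smallest prime factor: divisors divisible by p^2 contribute 0, and the
    others cancel in pairs d, p d with p not dividing d. *)
Lemma sum_moebius (m : nat) :
  (0 < m)%N -> \sum_(d <- divisors m) moebius d = (m == 1%N)%:R.
Proof.
move=> m0; have [->|m1] := eqVneq m 1%N.
  by rewrite /divisors /= big_seq1.
have pp : prime (pdiv m) by rewrite pdiv_prime //; lia.
set p := pdiv m in pp; have pm : (p %| m)%N by apply: pdiv_dvd.
rewrite (bigID (fun d => p %| d)%N) /=.
have -> : \sum_(d <- divisors m | (p %| d)%N) moebius d =
          \sum_(d <- divisors m | ~~ (p %| d)%N) moebius (p * d).
  rewrite -big_filter -[RHS]big_filter -(big_map (muln p) xpredT moebius).
  rewrite [LHS](bigID (fun d => p ^ 2 %| d)%N) /= big1_seq ?add0r; last first.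
    move=> d /andP[pd]; rewrite mem_filter -dvdn_divisors // => /andP[_ dm].
    rewrite /moebius (dvdn_gt0 m0 dm) /= ifF //; apply/negbTE/allPn; exists p.
      by rewrite mem_primes pp (dvdn_gt0 m0 dm) (dvdn_trans _ pd) // expnS dvdn_mulr.
    by rewrite negbK.
  rewrite -big_filter; apply: perm_big; apply: uniq_perm.
  - by rewrite !filter_uniq // divisors_uniq.
  - rewrite map_inj_uniq ?filter_uniq ?divisors_uniq //.
    by move=> x y /eqP; rewrite eqn_pmul2l ?prime_gt0 // => /eqP.
  move=> d; rewrite !mem_filter -dvdn_divisors //.
  apply/idP/mapP => [/and3P[pd p1 dm]|[e]].
    have [e de] := dvdnP p1; exists e; last by rewrite de mulnC.
    rewrite mem_filter -dvdn_divisors // (dvdn_trans _ dm) ?de ?dvdn_mulr // andbT.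
    by apply: contra pd => pe; rewrite de expnS expn1 dvdn_mul.
  rewrite mem_filter -dvdn_divisors // => /andP[pe em] ->.
  rewrite expnS expn1 dvdn_pmul2l ?prime_gt0 // pe dvdn_mulr //=.
  by rewrite Gauss_dvd ?pm // prime_coprime.
rewrite -big_split /= big1_seq // => d /andP[pd].
rewrite -dvdn_divisors // => dm.
by rewrite moebius_mul_prime ?(dvdn_gt0 m0 dm) // (negbTE pd) addNr.
Qed.

Lemma big_dvdn_nat (R : Type) (idx : R) (op : Monoid.com_law idx)
    (e m : nat) (F : nat -> R) :
  (0 < e)%N ->
  \big[op/idx]_(0 <= a < m.+1 | (e %| a)%N) F a =
  \big[op/idx]_(0 <= j < (m %/ e).+1) F (e * j)%N.
Proof.
move=> e0; elim: m => [|m IH].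
  by rewrite div0n big_mkcond !big_nat1 dvdn0 muln0.
rewrite big_mkcond big_nat_recr //= -big_mkcond IH divnS //.
case: ifP => [em|_]; last by rewrite add0n Monoid.mulm1.
rewrite add1n [RHS]big_nat_recr //=; congr (op _ (F _)).
have := divnS m e0; rewrite em add1n => <-.
by rewrite mulnC divnK.
Qed.

Lemma bin_prod (a b : nat) :
  'C(a + b, b)%:R = \prod_(0 <= j < b.+1 | (0 < j)%N) ((a%:R + j%:R) / j%:R) :> rat.
Proof.
elim: b => [|b IH]; first by rewrite bin0 big_mkcond big_nat1.
rewrite big_mkcond big_nat_recr //= -big_mkcond -IH.
have b0 : b.+1%:R != 0 :> rat by rewrite pnatr_eq0.
apply: (mulIf b0); rewrite -!mulrA mulVf // mulr1 -natrD -!natrM.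
congr (_%:R); have := mul_bin_diag (a + b).+1 b; rewrite /= addnS => e.
by rewrite mulnC -e mulnC.
Qed.

(* The exponent of [F a] is [\sum_(e | gcd(a, n)) moebius e], the indicator of
   [coprime n a]. *)
Lemma moebius_prod (n M : nat) (F : nat -> rat) : (0 < n)%N ->
  (forall a, (0 < a)%N -> F a != 0) ->
  \prod_(d <- divisors n)
     (\prod_(0 <= a < M | (d %| a)%N && (0 < a)%N) F a) ^ moebius d =
  \prod_(0 <= a < M | coprime n a && (0 < a)%N) F a.
Proof.
move=> n0 F0.
have prod_expz (P : pred nat) (z : int) :
    (\prod_(0 <= a < M | P a) F a) ^ z = \prod_(0 <= a < M | P a) F a ^ z.
  by elim/big_rec2: _ => [|a y x _ <-]; rewrite ?exp1rz // expfzMl.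
under eq_bigr => d _ do rewrite prod_expz big_mkcond.
rewrite exchange_big /= [RHS]big_mkcond; apply: eq_bigr => a _.
case: (posnP a) => [->|a0]; first by rewrite big1 ?andbF // => d _; rewrite andbF.
under eq_bigr => d _ do rewrite andbT; rewrite andbT -big_mkcond.
have -> : \prod_(d <- divisors n | (d %| a)%N) F a ^ moebius d =
          F a ^ (\sum_(d <- divisors (gcdn n a)) moebius d).
  have -> : \sum_(d <- divisors (gcdn n a)) moebius d =
            \sum_(d <- divisors n | (d %| a)%N) moebius d.
    rewrite -[RHS]big_filter; apply: perm_big; apply: uniq_perm.
    - exact: divisors_uniq.
    - by rewrite filter_uniq // divisors_uniq.
    move=> d; rewrite mem_filter -!dvdn_divisors ?gcdn_gt0 ?n0 //.
    by rewrite dvdn_gcd andbC.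
  by elim/big_rec2: _ => [|d y x _ ->] //; rewrite expfzDr ?F0.
by rewrite sum_moebius ?gcdn_gt0 ?n0 // /coprime; case: eqP.
Qed.

Lemma perm_divisors_div (n : nat) : (0 < n)%N ->
  perm_eq [seq (n %/ d)%N | d <- divisors n] (divisors n).
Proof.
move=> n0.
have divK d : (d %| n)%N -> (n %/ (n %/ d))%N = d.
  by move=> dn; rewrite divnA // mulKn.
apply: uniq_perm; rewrite ?divisors_uniq //.
  rewrite map_inj_in_uniq ?divisors_uniq // => x y.
  by rewrite -!dvdn_divisors // => xn yn e; rewrite -(divK x) // e divK.
move=> d; apply/mapP/idP => [[e]|]; rewrite -!dvdn_divisors // => dn.
  by move=> ->; rewrite dvdn_div.
by exists (n %/ d)%N; rewrite -?dvdn_divisors ?divK // dvdn_div.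
Qed.

(** With n = d e, the substitution a = e j turns the factors (k d + j) / j of the binomial into (k n
    + a) / a, where a runs over the multiples of e up to [v n / 2]. [moebius_prod] then applies
    after exchanging d and n / d. *)
Lemma moebius_bin_prod (n k v : nat) : (0 < n)%N -> odd n -> odd v ->
  \prod_(d <- divisors n)
       ('C(k * d + (v * d) %/ 2, (v * d - 1) %/ 2)%:R : rat)
         ^ moebius (n %/ d) =
  \prod_(0 <= a < ((v * n) %/ 2).+1 | coprime n a && (0 < a)%N)
     (((k * n)%:R + a%:R) / a%:R).
Proof.
move=> n0 on ov; rewrite -moebius_prod //; last first.
  move=> a a0; rewrite -natrD mulf_neq0 ?invr_eq0 ?pnatr_eq0 //.
    by rewrite addn_eq0 negb_and -!lt0n a0 orbT.
  by rewrite -lt0n.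
rewrite -[RHS](perm_big _ (perm_divisors_div n0)) big_map /=.
apply: eq_big_seq => d; rewrite -dvdn_divisors // => dn.
congr (_ ^ _); have [e ne] := dvdnP dn.
have d0 : (0 < d)%N by apply: dvdn_gt0 dn.
have e0 : (0 < e)%N by move: n0; rewrite ne muln_gt0 => /andP[].
rewrite ne mulnK //.
(* Since [v * d] is odd both floors agree, which gives the binomial the shape ['C(a + b, b)] of
   [bin_prod]. *)
have -> : ((v * d - 1) %/ 2 = (v * d) %/ 2)%N.
  have : odd (v * d) by move: on; rewrite ne !oddM ov => /andP[_ ->].
  by clear; lia.
rewrite bin_prod [RHS]big_mkcondr /= big_dvdn_nat // big_mkcond /=.
have -> : ((v * (e * d)) %/ 2 %/ e = (v * d) %/ 2)%N.
  by rewrite -divnMA [(2 * e)%N]mulnC divnMA mulnCA mulKn.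
apply: eq_bigr => j _; rewrite muln_gt0 e0 /=; case: ifP => // j0.
rewrite [in RHS](natrM _ e j) mulnCA [in RHS](natrM _ e).
have e0' : e%:R != 0 :> rat by rewrite pnatr_eq0 -lt0n.
have j0' : j%:R != 0 :> rat by rewrite pnatr_eq0 -lt0n.
by field; rewrite e0' j0'.
Qed.

(** * Faulhaber's formula over the integers prime to n *)

Lemma bin_mul_swap (m j l : nat) : (j + l <= m)%N ->
  ('C(m, j) * 'C(m - j, l) = 'C(m, l) * 'C(m - l, j))%N.
Proof.
move=> jl.
have f0 : (0 < j`! * l`! * (m - j - l)`!)%N by rewrite !muln_gt0 !fact_gt0.
apply/eqP; rewrite -(eqn_pmul2r f0); apply/eqP.
have jm : (j <= m)%N by lia.
have lm : (l <= m)%N by lia.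
have e1 := bin_fact jm; have e2 := bin_fact lm.
have e3 := @bin_fact (m - j) l ltac:(lia).
have e4 := @bin_fact (m - l) j ltac:(lia).
have e5 : (m - l - j = m - j - l)%N by lia.
rewrite e5 in e4.
transitivity (m`!); [rewrite -e1 -e3 | rewrite -e2 -e4]; ring.
Qed.

(** Induction on N. In the increment of the right-hand side, the coefficient of N^l is C(r+1, l)
    times the sum of C(r+1-l, j) B_j over j <= r - l. By [sum_bernoulli] it vanishes for l < r, and
    l = r yields (r+1) N^r. *)
Lemma faulhaber (r N : nat) :
  r.+1%:R * \sum_(0 <= a < N) a%:R ^+ r =
  \sum_(j < r.+1) 'C(r.+1, j)%:R * bernoulli j * N%:R ^+ (r.+1 - j) :> rat.
Proof.
elim: N => [|N IH].
  rewrite big_nil mulr0 big1 // => j _.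
  by rewrite expr0n subn_eq0 leqNgt ltnS -ltnS ltn_ord mulr0.
rewrite big_nat_recr //= mulrDr IH; apply/esym/eqP.
rewrite [X in _ == X]addrC -subr_eq -sumrB; apply/eqP.
transitivity (\sum_(j < r.+1) \sum_(l < r.+1 | (j + l <= r)%N)
   'C(r.+1, l)%:R * N%:R ^+ l * ('C(r.+1 - l, j)%:R * bernoulli j)).
  apply: eq_bigr => j _; rewrite -mulrBr -[N.+1%:R]natr1 [N%:R + 1]addrC exprDn.
  have -> : (r.+1 - j = (r - j).+1)%N by have := ltn_ord j; lia.
  rewrite big_ord_recr /= subnn mul1r binn mulr1n addrK mulr_sumr.
  rewrite (big_ord_widen_cond r.+1 xpredT (fun i : nat =>
      'C(r.+1, j)%:R * bernoulli j *
      (1 ^+ ((r - j).+1 - i) * N%:R ^+ i *+ 'C((r - j).+1, i)))) /=;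
    last by lia.
  apply: eq_big => [l|l jl]; first by rewrite ltnS leq_subRL // -ltnS.
  rewrite expr1n mul1r -[_ *+ _]mulr_natl.
  have jl1 : (j + l <= r.+1)%N by move: jl (ltn_ord j) => /=; lia.
  have e := bin_mul_swap jl1.
  have -> : ((r - j).+1 = r.+1 - j)%N by have := ltn_ord j; lia.
  transitivity (('C(r.+1, j) * 'C(r.+1 - j, l))%:R * N%:R ^+ l * bernoulli j).
    by rewrite natrM; ring.
  by rewrite e natrM; ring.
rewrite (exchange_big_dep xpredT) //=.
rewrite big_ord_recr /= [X in X + _]big1 ?add0r => [|l _].
  rewrite (bigD1 ord0) //= big1 => [|j /andP[jr j0]].
    by rewrite addr0 subSnn bin0 binSn /bernoulli /= big_ord0 mul0r subr0 !mulr1.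
  by exfalso; move: j0; rewrite -val_eqE /=; lia.
rewrite -mulr_sumr.
have e := sum_bernoulli (r - l).
rewrite (_ : (r - l == 0)%N = false) in e; last by have := ltn_ord l; lia.
have le : ((r - l).+1 <= r.+1)%N by lia.
rewrite (eq_bigl (fun j : 'I_r.+1 => (j < (r - l).+1)%N)); last first.
  by move=> j /=; have := ltn_ord l; have := ltn_ord j; lia.
rewrite -(big_ord_widen _ (fun j : nat => 'C(r.+1 - l, j)%:R * bernoulli j) le).
by rewrite subSn ?e ?mulr0 // ltnW.
Qed.

(** An arbitrary list of primes allows the Euler factors to be adjoined one at a time; at [primes n]
    this is [bernoulli_triv j n] by conversion. *)
Definition bernoulli_euler (ps : seq nat) (j : nat) : rat :=
  bernoulli j * \prod_(p <- ps) (1 - p%:R ^ (j%:Z - 1)).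

Lemma big_dvdn_lt (p N : nat) (P : pred nat) (F : nat -> rat) : (0 < p)%N ->
  \sum_(0 <= a < p * N | P a && (p %| a)%N) F a =
  \sum_(0 <= j < N | P (p * j)%N) F (p * j)%N.
Proof.
move=> p0; elim: N => [|N IH]; first by rewrite muln0 !big_nil.
rewrite mulnS addnC (big_cat_nat _ (n := (p * N)%N)) ?leq_addr //= IH.
rewrite [RHS]big_mkcond big_nat_recr //= -big_mkcond /=; congr (_ + _).
rewrite -[X in \sum_(X <= _ < _ | _) _]add0n big_addn.
rewrite addnC addnK big_mkcond big_ltn //= big1_seq ?addr0.
  by rewrite add0n dvdn_mulr // andbT.
move=> i /=; rewrite mem_index_iota dvdn_addl ?dvdn_mulr // => /andP[i0 ip].
by rewrite /dvdn modn_small // (gtn_eqF i0) andbF.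
Qed.

(* Adjoining a prime [p] removes the terms [p a] with [a < N / p], and
   [p^r (N / p)^(r + 1 - j) = p^(j - 1) N^(r + 1 - j)] yields the Euler factor. *)
Lemma faulhaber_primes (ps : seq nat) (r N : nat) :
  all prime ps -> uniq ps -> all (dvdn^~ N) ps ->
  r.+1%:R * \sum_(0 <= a < N | all (fun p => ~~ (p %| a)%N) ps) a%:R ^+ r =
  \sum_(j < r.+1) 'C(r.+1, j)%:R * bernoulli_euler ps j * N%:R ^+ (r.+1 - j) :> rat.
Proof.
elim: ps N => [|p ps IH] N /=.
  move=> _ _ _; rewrite faulhaber; apply: eq_bigr => j _.
  by rewrite /bernoulli_euler big_nil mulr1.
move=> /andP[pp aps] /andP[nps ups] /andP[pN aN].
have p0 := prime_gt0 pp.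
have pn0 : p%:R != 0 :> rat by rewrite pnatr_eq0 -lt0n.
have := IH N aps ups aN.
rewrite (bigID (fun a => p %| a)%N) /=.
have [M NM] := dvdnP pN.
rewrite [X in index_iota 0 X]NM mulnC big_dvdn_lt //.
have q_dvd q x : q \in ps -> (q %| p * x)%N = (q %| x)%N.
  move=> qps; have pq := allP aps q qps; rewrite Gauss_dvdr // prime_coprime //.
  by rewrite dvdn_prime2 //; apply: contraNneq nps => <-.
have aM : all (dvdn^~ M) ps.
  by apply/allP => q qps; have := allP aN q qps; rewrite NM mulnC q_dvd.
have emul : \sum_(0 <= j < M | all (fun q => ~~ (q %| p * j)%N) ps) (p * j)%:R ^+ r =
    p%:R ^+ r * \sum_(0 <= j < M | all (fun q => ~~ (q %| j)%N) ps) j%:R ^+ r :> rat.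
  rewrite mulr_sumr; apply: eq_big => [j|j _]; last by rewrite natrM exprMn.
  by apply: eq_in_all => q qps; rewrite q_dvd.
rewrite emul mulrDr mulrCA (IH M aps ups aM) => e.
rewrite (eq_bigl (fun a => all (fun q => ~~ (q %| a)%N) ps && ~~ (p %| a)%N));
  last by move=> a; rewrite andbC.
move/eqP: e; rewrite addrC eq_sym -subr_eq => /eqP; rewrite mulnC -NM => <-.
rewrite mulr_sumr -sumrB; apply: eq_bigr => j _.
rewrite /bernoulli_euler big_cons NM natrM exprMn.
have e : p%:R ^+ r = p%:R ^ (j%:Z - 1) * p%:R ^+ (r.+1 - j) :> rat.
  rewrite !exprnP -expfzDr //; congr (_ ^ _).
  by rewrite -subzn ?intS; [ring | rewrite ltnW].
by rewrite [in X in _ - X]e; ring.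
Qed.

(** * Congruences and half ranges *)

(** The modulus is any rational, not just a power of n: moduli s n^2 occur below, where s may share
    factors with n and is divided out later. *)
Definition eqmod (n : nat) (M x y : rat) : Prop :=
  exists2 z, z \in zloc n & x - y = M * z.

Lemma eqmod_refl n M x : eqmod n M x x.
Proof. by exists 0; rewrite ?rpred0 // subrr mulr0. Qed.

Lemma eqmod_trans n M x y z : eqmod n M x y -> eqmod n M y z -> eqmod n M x z.
Proof.
move=> [a an ea] [b bn eb]; exists (a + b); first by rewrite rpredD.
by rewrite mulrDr -ea -eb; ring.
Qed.

Lemma eqmodD n M x y x' y' :
  eqmod n M x y -> eqmod n M x' y' -> eqmod n M (x + x') (y + y').
Proof.
move=> [a an ea] [b bn eb]; exists (a + b); first by rewrite rpredD.
by rewrite mulrDr -ea -eb; ring.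
Qed.

Lemma eqmodMl n M c x y : c \in zloc n -> eqmod n M x y -> eqmod n M (c * x) (c * y).
Proof.
move=> cn [a an ea]; exists (c * a); first by rewrite rpredM.
by rewrite mulrCA -ea; ring.
Qed.

Lemma eqmod_scale n M c x y : eqmod n M x y -> eqmod n (c * M) (c * x) (c * y).
Proof. by move=> [a an ea]; exists a => //; rewrite -mulrA -ea; ring. Qed.

Lemma eqmod_sum n M (r : seq nat) (P : pred nat) (F G : nat -> rat) :
  (forall i, P i -> eqmod n M (F i) (G i)) ->
  eqmod n M (\sum_(i <- r | P i) F i) (\sum_(i <- r | P i) G i).
Proof.
move=> FG; elim/big_ind2: _ => //; first exact: eqmod_refl.
by move=> *; apply: eqmodD.
Qed.

Lemma prod_1D_eqmod n M (r : seq nat) (P : pred nat) (F : nat -> rat) :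
  M \in zloc n -> (forall i, P i -> F i \in zloc n) ->
  eqmod n (M ^+ 2) (\prod_(i <- r | P i) (1 + M * F i))
                   (1 + M * \sum_(i <- r | P i) F i).
Proof.
move=> Mn Fn; elim: r => [|i r IH]; rewrite ?big_nil ?big_cons.
  by rewrite mulr0 addr0; apply: eqmod_refl.
case: ifP => // Pi; have [z zn e] := IH.
have Sn : \sum_(j <- r | P j) F j \in zloc n by apply: rpred_sum.
exists ((1 + M * F i) * z + F i * \sum_(j <- r | P j) F j).
  by rewrite rpredD ?rpredM // ?rpredD ?rpred1 ?rpredM ?Fn.
by move/eqP: e; rewrite subr_eq => /eqP ->; ring.
Qed.

Lemma coprime_sub (n j : nat) : (j <= n)%N -> coprime n (n - j) = coprime n j.
Proof.
move=> /subnK e; move: (n - j)%N e => m <-; rewrite /coprime.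
by rewrite gcdnC gcdnDl gcdnC [in RHS]gcdnC gcdnDr.
Qed.

Section HalfRange.
Variables (n h : nat).
Hypotheses (n_odd : n = h.*2.+1) (n_gt1 : (1 < n)%N).

Variables (R : Type) (idx : R) (op : Monoid.com_law idx).

Lemma big_half_rev (F : nat -> R) :
  \big[op/idx]_(h.+1 <= i < n | coprime n i) F i =
  \big[op/idx]_(0 <= j < h.+1 | coprime n j) F (n - j)%N.
Proof.
(* The index 0 contributes nothing, since gcd(n, 0) = n > 1; its reflection n is therefore not
   missed on the left. *)
rewrite [RHS]big_mkcond big_ltn //= /coprime gcdn0 (gtn_eqF n_gt1) Monoid.mul1m.
rewrite -[X in \big[_/_]_(X <= _ < _ | _) _]add1n big_addn.
have -> : (n - h = h.+1)%N by lia.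
rewrite big_nat_rev [LHS]big_mkcond; apply: eq_big_nat => i /andP[i1 ih].
have -> : (1 + h.+1 - i.+1 + h = n - i)%N by lia.
by rewrite -!/(coprime _ _) coprime_sub //; lia.
Qed.

Lemma big_half (F : nat -> R) :
  \big[op/idx]_(0 <= i < n | coprime n i) F i =
  op (\big[op/idx]_(0 <= j < h.+1 | coprime n j) F j)
     (\big[op/idx]_(0 <= j < h.+1 | coprime n j) F (n - j)%N).
Proof.
rewrite -big_half_rev (big_cat_nat _ (n := h.+1)) //.
by rewrite n_odd; lia.
Qed.

(** As n is odd, the even residues are the 2 j and the odd ones the n - 2 j with j <= h. As 2 is
    prime to n, each is prime to n exactly when j is. *)
Lemma big_half_double (F : nat -> R) :
  \big[op/idx]_(0 <= i < n | coprime n i) F i =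
  op (\big[op/idx]_(0 <= j < h.+1 | coprime n j) F (2 * j)%N)
     (\big[op/idx]_(0 <= j < h.+1 | coprime n j) F (n - 2 * j)%N).
Proof.
pose G i := if coprime n i then F i else idx.
rewrite [LHS]big_mkcond -/(G _) (eq_bigr G) //.
have even_odd m : \big[op/idx]_(0 <= i < m.*2.+1) G i =
    op (\big[op/idx]_(0 <= j < m.+1) G (2 * j)%N)
       (\big[op/idx]_(0 <= j < m) G (2 * j).+1).
  elim: m => [|m IH]; first by rewrite !big_nat1 big_nil Monoid.mulm1.
  rewrite doubleS big_nat_recr // [in LHS]big_nat_recr //= IH.
  rewrite [in RHS]big_nat_recr // [X in _ = op _ X]big_nat_recr //=.
  rewrite mulnS !mul2n !addSn add0n -!Monoid.mulmA; congr (op _ _).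
  by rewrite [LHS]Monoid.mulmA [LHS]Monoid.mulmC.
rewrite [in LHS]n_odd even_odd; congr (op _ _).
  rewrite [RHS]big_mkcond; apply: eq_bigr => j _.
  by rewrite /G coprimeMr coprimen2 n_odd /= odd_double.
rewrite [RHS]big_mkcond [RHS]big_ltn //= /coprime gcdn0 (gtn_eqF n_gt1) Monoid.mul1m.
rewrite big_nat_rev big_add1; apply: eq_big_nat => i /andP[_ ih].
rewrite -!/(coprime _ _) /G.
have -> : ((2 * (0 + h - i.+1)).+1 = n - 2 * i.+1)%N by lia.
rewrite coprime_sub; last by lia.
by rewrite coprimeMr coprimen2 n_odd /= odd_double.
Qed.

End HalfRange.

(** * Integrality of the generalized Bernoulli numbers *)

Lemma coprime_primesE (n a : nat) :
  (0 < n)%N -> coprime n a = all (fun p => ~~ (p %| a)%N) (primes n).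
Proof.
move=> n0; apply/idP/allP => [cna p|pna].
  rewrite mem_primes => /and3P[pp _ pn]; rewrite -prime_coprime //.
  exact: coprime_dvdl cna.
apply: contraT => ng1.
have gp : prime (pdiv (gcdn n a)).
  rewrite pdiv_prime // ltn_neqAle eq_sym gcdn_gt0 n0 andbT; exact: ng1.
have gd := pdiv_dvd (gcdn n a).
have := pna (pdiv (gcdn n a)).
rewrite mem_primes gp n0 (dvdn_trans gd (dvdn_gcdl _ _)).
by rewrite (dvdn_trans gd (dvdn_gcdr _ _)) => /(_ isT).
Qed.

(** Faulhaber's formula at N = n, divided by r + 1, with the top term j = r isolated: a recursion
    for n B_{r, chi_n}. *)
Lemma bernoulli_triv_rec (n r : nat) : (0 < n)%N ->
  \sum_(0 <= a < n | coprime n a) a%:R ^+ r =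
  n%:R * bernoulli_triv r n +
  \sum_(j < r) 'C(r, j)%:R * (n%:R * bernoulli_triv j n)
                * (n%:R ^+ (r - j) / (r - j).+1%:R) :> rat.
Proof.
move=> n0; have r0 : r.+1%:R != 0 :> rat by rewrite pnatr_eq0.
apply: (mulfI r0).
have := @faulhaber_primes (primes n) r n _ (primes_uniq n).
rewrite (eq_bigl (coprime n)); last by move=> a; rewrite coprime_primesE.
move=> ->; first last.
- by apply/allP => p; rewrite mem_primes => /and3P[].
- by apply/allP => p; rewrite mem_primes => /and3P[].
rewrite big_ord_recr /= subSnn binSn expr1 addrC mulrDr mulr_sumr.
have trivE i : bernoulli_euler (primes n) i = bernoulli_triv i n by [].
rewrite trivE -mulrA [bernoulli_triv r n * _]mulrC; congr (_ + _).
apply: eq_bigr => j _; rewrite trivE.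
have jr := ltn_ord j.
have rj : (r - j).+1%:R != 0 :> rat by rewrite pnatr_eq0.
have e : ('C(r.+1, j)%:R = r.+1%:R * 'C(r, j)%:R / (r - j).+1%:R :> rat).
  apply: (mulIf rj); rewrite mulfVK // -!natrM -subSn; last exact: ltnW.
  by rewrite mulnC -mul_bin_down.
rewrite e subSn 1?ltnW // exprS.
by move: (r - j).+1%:R rj => m m0; field.
Qed.

(** A weak von Staudt theorem, by strong induction: the coefficients n^(r-j) / (r-j+1) of the
    recursion are integral because r-j+1 < 5^(r-j+1). *)
Lemma zloc_bernoulli_triv (n r : nat) : gcdn n 6 = 1%N ->
  n%:R * bernoulli_triv r n \in zloc n.
Proof.
move=> n6; have n0 : (0 < n)%N by case: n n6.
elim/ltn_ind: r => r IH.
have /eqP := bernoulli_triv_rec r n0; rewrite -subr_eq eq_sym => /eqP ->.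
rewrite rpredB //; apply: rpred_sum => j _; first by rewrite rpredX ?rpred_nat.
apply: rpredM; first by rewrite rpredM ?rpred_nat ?IH.
by apply: zloc_expn_div => //=; apply: ltn_expl.
Qed.

Lemma odd_of_gcdn6 (n : nat) : gcdn n 6 = 1%N -> odd n.
Proof.
by move=> n6; rewrite -coprimen2; apply: (@coprime_dvdr _ 6); rewrite // /coprime n6.
Qed.

Lemma zloc_half (n : nat) : odd n -> 2^-1 \in zloc n.
Proof. by move=> on; apply: (@zlocV n 2); rewrite coprimen2. Qed.

(** From C(s, i+2) = s C(s-1, i+1) / (i+2), each remaining binomial term is s n^2 times an integral
    multiple of n^i / (i+2), and i+2 < 5^(i+1). Keeping s in the modulus permits a later division by
    s. *)
Lemma zloc_expD (n s : nat) (x y : rat) : gcdn n 6 = 1%N -> (0 < s)%N ->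
  x \in zloc n -> y \in zloc n ->
  eqmod n (s%:R * n%:R ^+ 2) ((x + n%:R * y) ^+ s)
    (x ^+ s + s%:R * n%:R * y * x ^+ s.-1).
Proof.
case: s => // s n6 _ xn yn; rewrite exprDn !big_ord_recl /= bin0 bin1.
rewrite /bump /= expr0 mulr1 mulr1n subn0 expr1 subn1 /=.
exists (\sum_(i < s) x ^+ (s.+1 - i.+2) * y ^+ i.+2 * 'C(s, i.+1)%:R *
                       (n%:R ^+ i / i.+2%:R)).
  apply: rpred_sum => i _; apply: rpredM.
    by apply: rpredM (rpred_nat _ _); apply: rpredM; apply: rpredX.
  apply: zloc_expn_div => //=.
  by elim: (i : nat) => [|j IH] //; rewrite expnS; lia.
have addE (a b c d e : rat) : b = d -> c = e -> a + (b + c) - (a + d) = e.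
  by move=> -> ->; ring.
rewrite mulr_sumr; apply: addE; first by rewrite -[_ *+ _]mulr_natl; ring.
apply: eq_bigr => i _; rewrite !add1n exprMn -[_ *+ _]mulr_natr.
have i0 : i.+2%:R != 0 :> rat by rewrite pnatr_eq0.
have e : ('C(s.+1, i.+2)%:R = s.+1%:R * 'C(s, i.+1)%:R / i.+2%:R :> rat).
  by apply: (mulIf i0); rewrite mulfVK // -!natrM mulnC -mul_bin_diag.
rewrite e !exprS.
by move: i.+2%:R i0 => m m0; field.
Qed.

Lemma zloc_bernoulli_triv_odd (n r : nat) : gcdn n 6 = 1%N -> (1 < n)%N -> odd r ->
  bernoulli_triv r n \in zloc n.
Proof.
move=> n6 n1 r_odd; have n0 : (0 < n)%N by case: n n6 n1.
have nq0 : n%:R != 0 :> rat by rewrite pnatr_eq0 -lt0n.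
have [h nh] : exists h, n = h.*2.+1.
  by exists n./2; rewrite -[LHS]odd_double_half odd_of_gcdn6.
have -> : bernoulli_triv r n = (n%:R * bernoulli_triv r n) / n%:R.
  by rewrite mulrC mulKf.
have /eqP := bernoulli_triv_rec r n0; rewrite -subr_eq eq_sym => /eqP ->.
rewrite mulrBl rpredB //.
  rewrite (big_half nh n1) /= -big_split /= mulr_suml.
  rewrite big_seq_cond; apply: rpred_sum => j /andP[cj _].
  have jn : (j <= n)%N by move: cj; rewrite mem_index_iota => /andP[_]; lia.
  have Njn : - j%:R \in zloc n by rewrite rpredN rpred_nat.
  have [z zn] := zloc_expD n6 (odd_gt0 r_odd) Njn (rpred1 _).
  rewrite mulr1 [- j%:R + n%:R]addrC -natrB // exprNn -signr_odd r_odd expr1 mulN1r mulr1.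
  move/eqP; rewrite subr_eq => /eqP ->.
  have -> a b c : (a + (c + (- a + b))) / n%:R = (c + b) / n%:R :> rat.
    by congr (_ / _); ring.
  rewrite (_ : _ / _ = r%:R * n%:R * z + r%:R * (- j%:R) ^+ r.-1); last by field.
  apply: rpredD; first by do 2!apply: rpredM => //; apply: rpred_nat.
  by apply: rpredM; [apply: rpred_nat | apply: rpredX].
rewrite mulr_suml; apply: rpred_sum => j _.
have jr := ltn_ord j.
have -> : (r - j = (r - j).-1.+1)%N by lia.
move: (r - j).-1 => i; rewrite exprS.
have -> : 'C(r, j)%:R * (n%:R * bernoulli_triv j n) * (n%:R * n%:R ^+ i / i.+2%:R) / n%:R =
  'C(r, j)%:R * (n%:R * bernoulli_triv j n) * (n%:R ^+ i / i.+2%:R).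
  have i0 : i.+2%:R != 0 :> rat by rewrite pnatr_eq0.
  by move: i.+2%:R i0 => m m0; field; rewrite nq0 m0.
apply: rpredM; first by rewrite rpredM ?rpred_nat ?zloc_bernoulli_triv.
apply: zloc_expn_div => //=; elim: i => [|i IH] //; rewrite expnS; lia.
Qed.

(** * Half-range sums and beta *)

(** Writing C(s, j) = s C(s-1, j) / (s-j) in the recursion extracts s n^2 from every lower term and
    leaves the two consecutive denominators s-j and s-j+1. *)
Lemma power_sum_eqmod (n s : nat) : gcdn n 6 = 1%N -> (1 < n)%N ->
  ~~ odd s -> (1 < s)%N ->
  eqmod n (s%:R * n%:R ^+ 2) (\sum_(0 <= a < n | coprime n a) a%:R ^+ s)
    (n%:R * bernoulli_triv s n).
Proof.
case: s => // s n6 n1 /= s_odd _; rewrite negbK in s_odd.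
have n_odd := odd_of_gcdn6 n6.
rewrite bernoulli_triv_rec; last exact: ltnW.
exists (\sum_(j < s.+1) 'C(s, j)%:R * (bernoulli_triv j n * n%:R ^+ (s - j) /
    ((s - j).+1%:R * (s - j).+2%:R))).
  apply: rpred_sum => j _; apply: rpredM; first exact: rpred_nat.
  (* In the case j = s no power of n is left to clear the denominator of B_j, but here j is odd. *)
  have := ltn_ord j; rewrite ltnS leq_eqVlt => /orP[/eqP ->|js].
    rewrite subnn expr0 mulr1 mul1r; apply: rpredM; last exact: zloc_half.
    exact: zloc_bernoulli_triv_odd.
  have -> : (s - j = (s - j).-1.+1)%N by lia.
  (* One n goes with B_j; the remaining n^i is shared out as n^t for each of the denominators i+2
     and i+3, both below 5^(t+1). *)
  move: (s - j).-1 => i; pose t := i./2.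
  have [t0 it] : (odd i + t + t = i)%N /\ (i.+3 < 5 ^ t.+1)%N.
    have := odd_double_half i; rewrite -/t -addnn => e; split; first by lia.
    have : (t.*2.+4 < 5 ^ t.+1)%N.
      by elim: (t) => // q IH; rewrite expnS; lia.
    by move: e; case: (odd i) => /=; lia.
  rewrite exprS mulrA [bernoulli_triv j n * _]mulrC -mulrA; apply: rpredM.
    exact: zloc_bernoulli_triv.
  rewrite -{1}t0 !exprD.
  rewrite (_ : _ / _ = n%:R ^+ odd i * (n%:R ^+ t / i.+2%:R) * (n%:R ^+ t / i.+3%:R)).
    apply: rpredM; last by apply: zloc_expn_div.
    apply: rpredM; first by rewrite rpredX ?rpred_nat.
    by apply: zloc_expn_div => //=; apply: ltnW.
  by rewrite invfM; ring.
rewrite addrC addKr mulr_sumr; apply: eq_bigr => j _.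
have js : (j <= s)%N by rewrite -ltnS.
have e : 'C(s.+1, j)%:R = s.+1%:R * 'C(s, j)%:R / (s - j).+1%:R :> rat.
  have sj : (s - j).+1%:R != 0 :> rat by rewrite pnatr_eq0.
  apply: (mulIf sj); rewrite mulfVK // -!natrM -subSn //.
  by rewrite mulnC -mul_bin_down.
by rewrite e subSn // exprS invfM; ring.
Qed.

Section HalfSums.
Variables (n h : nat).
Hypotheses (n6 : gcdn n 6 = 1%N) (n1 : (1 < n)%N) (nh : n = h.*2.+1).

(* Split the sum of [i^s] over the residues prime to [n] in two ways, as
   [{j, n - j}] and as [{2 j, n - 2 j}] with [j < n / 2]. *)
Lemma bernoulli_half (s : nat) : ~~ odd s -> (1 < s)%N ->
  eqmod n n%:R ((2 ^+ s - 1) * (bernoulli_triv s n / s%:R))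
    (- 2 ^+ s.-1 * \sum_(0 <= j < h.+1 | coprime n j) j%:R ^+ s.-1).
Proof.
move=> s_even s1; have s0 : (0 < s)%N by apply: ltnW.
have expB a : (a <= n)%N -> eqmod n (s%:R * n%:R ^+ 2) ((n - a)%:R ^+ s)
    (a%:R ^+ s - s%:R * n%:R * a%:R ^+ s.-1).
  move=> an; have Nan : - a%:R \in zloc n by rewrite rpredN rpred_nat.
  have := zloc_expD n6 s0 Nan (rpred1 _).
  have -> : (- a%:R) ^+ s = a%:R ^+ s :> rat.
    by rewrite exprNn -signr_odd (negbTE s_even) mul1r.
  have -> : (- a%:R) ^+ s.-1 = - a%:R ^+ s.-1 :> rat.
    rewrite exprNn -signr_odd.
    have -> : odd s.-1 by case: (s) s0 s_even => //= q _; rewrite negbK.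
    by rewrite mulN1r.
  by rewrite !mulr1 mulrN [- a%:R + _]addrC -natrB.
have [z zn Tz] := power_sum_eqmod n6 n1 s_even s1.
set T := \sum_(0 <= a < n | _) _ in Tz.
pose H r : rat := \sum_(0 <= j < h.+1 | coprime n j) j%:R ^+ r.
have [z1 z1n T1] : eqmod n (s%:R * n%:R ^+ 2) T (H s + (H s - s%:R * n%:R * H s.-1)).
  rewrite /T (big_half nh n1) /=; apply: eqmodD; first exact: eqmod_refl.
  rewrite mulr_sumr -sumrB big_seq_cond [X in eqmod _ _ _ X]big_seq_cond.
  apply: eqmod_sum => j /andP[]; rewrite mem_index_iota => /andP[_ jh] _.
  by apply: expB; lia.
have [z2 z2n T2] : eqmod n (s%:R * n%:R ^+ 2) T
    (2 ^+ s * H s + (2 ^+ s * H s - s%:R * n%:R * 2 ^+ s.-1 * H s.-1)).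
  rewrite /T (big_half_double nh n1) /=; apply: eqmodD.
    rewrite mulr_sumr; apply: eqmod_sum => j _; rewrite natrM exprMn; exact: eqmod_refl.
  rewrite !mulr_sumr -sumrB big_seq_cond [X in eqmod _ _ _ X]big_seq_cond.
  apply: eqmod_sum => j /andP[]; rewrite mem_index_iota => /andP[_ jh] _.
  have := @expB (2 * j)%N ltac:(lia).
  by rewrite natrM !exprMn !mulrA.
exists (2 ^+ s * z1 - z2 - (2 ^+ s - 1) * z).
  by rewrite !(rpredB, rpredM) // ?rpredX ?rpred1 // rpred_nat.
have n0 : n%:R != 0 :> rat by rewrite pnatr_eq0 -lt0n ltnW.
have sq0 : s%:R != 0 :> rat by rewrite pnatr_eq0 -lt0n.
apply: (mulfI (mulf_neq0 sq0 n0)).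
rewrite -[\sum_(_ <= _ < _ | _) _]/(H s.-1).
set B := bernoulli_triv s n in Tz *.
have -> : s%:R * n%:R * ((2 ^+ s - 1) * (B / s%:R) - - 2 ^+ s.-1 * H s.-1) =
  (2 ^+ s - 1) * (n%:R * B) + s%:R * n%:R * 2 ^+ s.-1 * H s.-1.
  by field.
have -> : n%:R * B = T - s%:R * n%:R ^+ 2 * z by rewrite -Tz; ring.
(* Subtracting the second splitting from 2^s times the first cancels [H s]. Dividing by s n then
   reduces the modulus from s n^2 to n. *)
transitivity (2 ^+ s * (T - (H s + (H s - s%:R * n%:R * H s.-1)))
   - (T - (2 ^+ s * H s + (2 ^+ s * H s - s%:R * n%:R * 2 ^+ s.-1 * H s.-1)))
   - (2 ^+ s - 1) * (s%:R * n%:R ^+ 2 * z)).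
  have -> : 2 ^+ s = 2 * 2 ^+ s.-1 :> rat by rewrite -exprS prednK.
  by ring.
by rewrite T1 T2; ring.
Qed.

Lemma coprime_nat_neq0 j : coprime n j -> j%:R != 0 :> rat.
Proof.
move=> cj; rewrite pnatr_eq0; apply: contraTneq cj => ->.
by rewrite /coprime gcdn0 gtn_eqF.
Qed.

(** The expansion of j^-2 (1 - n/j)^-2 to first order in n, with its exact remainder as witness; the
    next lemma expands - j^-2 (1 - n/j)^-1 likewise. *)
Lemma inv_sq_eqmod j : (j <= n)%N -> coprime n j ->
  eqmod n (n%:R ^+ 2) ((n - j)%:R ^- 2) (j%:R ^- 2 + 2 * n%:R * j%:R ^- 3).
Proof.
move=> jn cj; have cnj : coprime n (n - j) by rewrite coprime_sub.
have j0 := coprime_nat_neq0 cj; have nj0 := coprime_nat_neq0 cnj.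
exists ((3 * j%:R - 2 * n%:R) * (j%:R^-1 ^+ 3 * (n - j)%:R^-1 ^+ 2)).
  apply: rpredM; first by rewrite rpredB // rpredM // rpred_nat.
  by apply: rpredM; apply: rpredX; apply: zlocV.
move: nj0; rewrite natrB // => nj0; field; by rewrite j0 nj0.
Qed.

Lemma inv_mul_eqmod j : (j <= n)%N -> coprime n j ->
  eqmod n (n%:R ^+ 2) ((j%:R * (n%:R - j%:R))^-1) (- (j%:R ^- 2 + n%:R * j%:R ^- 3)).
Proof.
move=> jn cj; have cnj : coprime n (n - j) by rewrite coprime_sub.
have j0 := coprime_nat_neq0 cj; have nj0 := coprime_nat_neq0 cnj.
exists (j%:R^-1 ^+ 3 * (n - j)%:R^-1).
  by apply: rpredM; [apply: rpredX|]; apply: zlocV.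
move: nj0; rewrite natrB // => nj0; field; by rewrite j0 nj0.
Qed.

Definition Hsum (r : nat) : rat := \sum_(0 <= j < h.+1 | coprime n j) j%:R ^- r.
Definition Esum : rat :=
  \sum_(0 <= j < h.+1 | coprime n j) (j%:R * (n%:R - j%:R))^-1.

Lemma Esum_eqmod : eqmod n (n%:R ^+ 2) Esum (- (Hsum 2 + n%:R * Hsum 3)).
Proof.
rewrite /Esum /Hsum mulr_sumr -big_split -sumrN /= big_seq_cond.
rewrite [X in eqmod _ _ _ X]big_seq_cond; apply: eqmod_sum => j /andP[].
by rewrite mem_index_iota => /andP[_ jh] cj; apply: inv_mul_eqmod => //; lia.
Qed.

Lemma zlocV_6 : 6^-1 \in zloc n.
Proof. by apply: (@zlocV n 6); rewrite /coprime n6. Qed.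

(* The same two splittings as in [bernoulli_half], for the sum of [i^-2]. *)
Lemma Hsum2_eqmod : eqmod n (n%:R ^+ 2) (Hsum 2) (- (7 / 6) * n%:R * Hsum 3).
Proof.
pose S : rat := \sum_(0 <= i < n | coprime n i) i%:R ^- 2.
have [z1 z1n S1] : eqmod n (n%:R ^+ 2) S (Hsum 2 + (Hsum 2 + 2 * n%:R * Hsum 3)).
  rewrite /S (big_half nh n1) /=; apply: eqmodD; first exact: eqmod_refl.
  rewrite mulr_sumr -big_split /= big_seq_cond [X in eqmod _ _ _ X]big_seq_cond.
  apply: eqmod_sum => j /andP[]; rewrite mem_index_iota => /andP[_ jh] cj.
  by apply: inv_sq_eqmod => //; lia.
have [z2 z2n S2] : eqmod n (n%:R ^+ 2) S
    (4^-1 * Hsum 2 + (4^-1 * Hsum 2 + 4^-1 * n%:R * Hsum 3)).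
  rewrite /S (big_half_double nh n1) /=; apply: eqmodD.
    rewrite mulr_sumr; apply: eqmod_sum => j cj.
    have j0 := coprime_nat_neq0 cj.
    rewrite natrM (_ : _ ^- 2 = 4^-1 * j%:R ^- 2); first exact: eqmod_refl.
    by field.
  rewrite !mulr_sumr -big_split /= big_seq_cond [X in eqmod _ _ _ X]big_seq_cond.
  apply: eqmod_sum => j /andP[]; rewrite mem_index_iota => /andP[_ jh] cj.
  have c2j : coprime n (2 * j) by rewrite coprimeMr coprimen2 odd_of_gcdn6.
  have j0 := coprime_nat_neq0 cj.
  have := @inv_sq_eqmod (2 * j)%N ltac:(lia) c2j.
  rewrite natrM (_ : (2 * j%:R) ^- 2 + _ = 4^-1 * j%:R ^- 2 + 4^-1 * n%:R * j%:R ^- 3) //.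
  by field.
(* Equating the two splittings gives (3/2) H2 = - (7/4) n H3 modulo n^2; the factor 4/6 is the
   inverse of 3/2. *)
exists (4 * 6^-1 * (z2 - z1)).
  by rewrite !rpredM ?rpredB ?zlocV_6 // rpred_nat.
have -> : n%:R ^+ 2 * (4 / 6 * (z2 - z1)) = 4 / 6 * (n%:R ^+ 2 * z2 - n%:R ^+ 2 * z1).
  by ring.
by rewrite -S1 -S2; field.
Qed.

End HalfSums.

Lemma euler_eqmod (n a : nat) : coprime n a -> (0 < a)%N ->
  eqmod n n%:R (a%:R ^+ totient n) 1.
Proof.
move=> cna a0; have := Euler_exp_totient (a := a) (n := n).
rewrite coprime_sym cna => /(_ isT) /eqP.
rewrite eqn_mod_dvd ?expn_gt0 ?a0 // => /dvdnP[w e].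
exists w%:R; first exact: rpred_nat.
by rewrite -natrX -[1]/(1%:R) -natrB ?expn_gt0 ?a0 // e natrM mulrC.
Qed.

Section HalfTotient.
Variables (n h : nat).
Hypotheses (n6 : gcdn n 6 = 1%N) (n1 : (1 < n)%N) (nh : n = h.*2.+1).

Let K := (\sum_(0 <= j < h.+1 | coprime n j) 1)%N.

Lemma totient_half : totient n = K.*2.
Proof.
rewrite totient_count_coprime -addnn -(big_half nh n1 addn (fun=> 1%N)) [RHS]big_mkcond.
by apply: eq_bigr => i _; case: coprime.
Qed.

(** Both 1 and 2 are prime to n and at most h, since h = 1 would mean n = 3. Hence s = phi(n) - 2 is
    at least 2 and its truncated subtraction is exact. *)
Lemma half_card_gt1 : (1 < K)%N.
Proof.
have n_odd : odd n by apply: odd_of_gcdn6.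
have h1 : h <> 1%N by move=> e; move: n6; rewrite nh e.
have [m hm] : exists m, h = m.+2 by exists (h - 2)%N; lia.
rewrite /K big_mkcond hm 3?big_ltn // coprimen1 coprimen2 n_odd.
by case: coprime.
Qed.

Lemma prod_half_const (c : rat) :
  \prod_(0 <= j < h.+1 | coprime n j) c = c ^+ K.
Proof.
rewrite /K; elim/big_rec2: _ => [|i y x _ ->]; first by rewrite expr0.
by rewrite add1n exprS.
Qed.

Let s := (totient n - 2)%N.
Let beta := bernoulli_triv s n / s%:R.

(** Here s - 1 = phi(n) - 3, so Euler's theorem turns j^(s-1) into j^-3. *)
Lemma half_power_eqmod :
  eqmod n n%:R (\sum_(0 <= j < h.+1 | coprime n j) j%:R ^+ s.-1) (Hsum n h 3).
Proof.
apply: eqmod_sum => j cj; have j0 := coprime_nat_neq0 n1 cj.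
have jn : j%:R^-1 \in zloc n by apply: zlocV.
have jp : (0 < j)%N by rewrite lt0n -(pnatr_eq0 rat).
have [w wn e] := euler_eqmod cj jp.
exists (j%:R^-1 ^+ 3 * w); first by rewrite rpredM // rpredX.
rewrite mulrCA -e.
have -> : totient n = (s.-1 + 3)%N.
  by rewrite /s; have := half_card_gt1; rewrite totient_half; lia.
by rewrite exprD; field.
Qed.

(** Modulo n, four times 2^s is 2^phi(n) = 1, so four times [bernoulli_half] reads - 3 beta = - H3 /
    2. Integrality of beta comes first, from 2^s - 1 being a unit. *)
Lemma beta_half : beta \in zloc n /\ eqmod n n%:R beta (Hsum n h 3 / 6).
Proof.
have K1 := half_card_gt1; have phiE := totient_half.
have sE : s = K.-1.*2 by rewrite /s phiE; lia.
have s1 : (1 < s)%N by rewrite sE; lia.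
have s_even : ~~ odd s by rewrite sE odd_double.
have n_odd := odd_of_gcdn6 n6.
have c2 : coprime n 2 by rewrite coprimen2.
have [w wn ew] := euler_eqmod c2 isT.
have phis : totient n = s.+2 by rewrite /s; lia.
have [z zn ez] := bernoulli_half n6 n1 nh s_even s1; rewrite -/beta in ez.
have [y yn ey] := half_power_eqmod.
set Hs := \sum_(0 <= j < _ | _) _ in ez ey.
have Hsn : Hs \in zloc n by apply: rpred_sum => j _; rewrite rpredX ?rpred_nat.
have q0 : (0 < 2 ^ s)%N by rewrite expn_gt0.
have qE : 2 ^+ s - 1 = (2 ^ s - 1)%N%:R :> rat by rewrite natrB // natrX.
(* A common divisor of n and 2^s - 1 divides 2^phi(n) - 1 = 4 (2^s - 1) + 3, hence 3, hence gcd(n,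
   6) = 1. *)
have qn : (2 ^+ s - 1)^-1 \in zloc n.
  rewrite qE; apply: zlocV; rewrite /coprime -dvdn1; set d := gcdn n _.
  have dn : (d %| n)%N by apply: dvdn_gcdl.
  have dq : (d %| 2 ^ s - 1)%N by apply: dvdn_gcdr.
  have : (n %| 2 ^ totient n - 1)%N.
    rewrite -eqn_mod_dvd ?expn_gt0 //; apply/eqP; apply: Euler_exp_totient.
    by rewrite coprime_sym.
  move=> /(dvdn_trans dn); rewrite phis !expnS.
  have -> : (2 * (2 * 2 ^ s) - 1 = 4 * (2 ^ s - 1) + 3)%N by lia.
  rewrite dvdn_addr ?dvdn_mull // => d3.
  by rewrite -n6 dvdn_gcd dn (dvdn_trans d3).
have qq0 : 2 ^+ s - 1 != 0 :> rat.
  rewrite qE pnatr_eq0 -lt0n; have : (2 ^ 2 <= 2 ^ s)%N by rewrite leq_exp2l.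
  by lia.
have bE : beta = (2 ^+ s - 1)^-1 * (- 2 ^+ s.-1 * Hs + n%:R * z).
  have -> : - 2 ^+ s.-1 * Hs + n%:R * z = (2 ^+ s - 1) * beta by rewrite -ez; ring.
  by rewrite mulKf.
have bn : beta \in zloc n.
  rewrite bE; apply: rpredM => //; apply: rpredD; apply: rpredM => //.
    by rewrite rpredN rpredX // rpred_nat.
  exact: rpred_nat.
split=> //.
exists (w / 6 * Hs - 8 / 6 * z + 2 / 6 * w * beta + y / 6).
  have v6 := zlocV_6 n6.
  have c6 m : m%:R / 6 \in zloc n by apply: rpredM v6; apply: rpred_nat.
  apply: rpredD; last exact: rpredM.
  apply: rpredD; last by do 2?[apply: rpredM => //].
  by apply: rpredB; do 2?[apply: rpredM => //].
have e4 : 4 * ((2 ^+ s - 1) * beta - - 2 ^+ s.-1 * Hs) = 4 * n%:R * z by rewrite ez mulrA.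
have ep : 2 ^+ totient n = 8 * 2 ^+ s.-1 :> rat.
  by rewrite phis -(@prednK s) ?(ltnW s1) // !exprS /=; ring.
have es : 2 ^+ s = 2 * 2 ^+ s.-1 :> rat by rewrite -exprS prednK // ltnW.
rewrite es in e4; rewrite ep in ew.
have hE : Hsum n h 3 = Hs - n%:R * y by rewrite -ey; ring.
rewrite hE.
transitivity (6^-1 * (n%:R * w) * Hs - 2 / 6 * (4 * n%:R * z)
  + 2 / 6 * (n%:R * w) * beta + n%:R * y / 6); last by field.
by rewrite -ew -e4; field.
Qed.

Lemma Hsum2_beta : eqmod n (n%:R ^+ 2) (Hsum n h 2) (- 7 * n%:R * beta).
Proof.
have [bn [y yn ey]] := beta_half; have [z zn ez] := Hsum2_eqmod n6 n1 nh.
exists (z + 7 * y); first by rewrite rpredD // rpredM // rpred_nat.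
rewrite mulrDr -ez [_ * (7 * y)](_ : _ = 7 * n%:R * (n%:R * y)); last by ring.
by rewrite -ey; move: beta (Hsum _ _ 2) (Hsum _ _ 3) => b H2 H3; field.
Qed.

(** E = - (H2 + n H3), where H2 = - 7 n beta and n H3 = 6 n beta modulo n^2. *)
Lemma Esum_beta : eqmod n (n%:R ^+ 2) (Esum n h) (n%:R * beta).
Proof.
have [bn [y yn ey]] := beta_half; have [z zn ez] := Hsum2_beta.
have [x xn ex] := Esum_eqmod n6 n1 nh.
exists (x - z + 6 * y); first by rewrite rpredD ?rpredB // rpredM // rpred_nat.
have -> : n%:R ^+ 2 * (x - z + 6 * y) =
    n%:R ^+ 2 * x - n%:R ^+ 2 * z + 6 * n%:R * (n%:R * y) by ring.
rewrite -ex -ez -ey.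
by move: beta (Esum _ _) (Hsum _ _ 2) (Hsum _ _ 3) => b E H2 H3; field.
Qed.

End HalfTotient.

(** * The quotient of consecutive products *)

Section Blocks.
Variables (n h : nat).
Hypotheses (n6 : gcdn n 6 = 1%N) (n1 : (1 < n)%N) (nh : n = h.*2.+1).

Lemma big_coprime_shift (R : Type) (idx : R) (op : Monoid.com_law idx)
    (c x y : nat) (F : nat -> R) :
  \big[op/idx]_(x + c * n <= i < y + c * n | coprime n i) F i =
  \big[op/idx]_(x <= i < y | coprime n i) F (i + c * n)%N.
Proof.
rewrite big_addn addnK; apply: eq_bigl => i.
by rewrite /coprime addnC gcdnMDl.
Qed.

(** [block_even c] runs over the integers prime to n between c n and (c+1) n, and [block_odd g] over
    those in the block of length n centred at g n, each paired by reflection in the centre. [cprod]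
    is the Gauss factorial. *)
Let block_even (c : nat) : rat := \prod_(0 <= j < h.+1 | coprime n j)
  ((c%:R * n%:R + j%:R) * (c%:R * n%:R + n%:R - j%:R)).
Let block_odd (g : nat) : rat := \prod_(0 <= j < h.+1 | coprime n j)
  ((g%:R * n%:R - j%:R) * (g%:R * n%:R + j%:R)).
Let cprod (x : nat) : rat := \prod_(0 <= i < x | coprime n i) i%:R.

Lemma cprod_neq0 x : cprod x != 0.
Proof.
by rewrite prodf_seq_neq0; apply/allP => i _; apply/implyP; apply: coprime_nat_neq0.
Qed.

Lemma cprodD y c : cprod (y + c * n) =
  cprod (c * n) * \prod_(0 <= i < y | coprime n i) (c%:R * n%:R + i%:R).
Proof.
rewrite /cprod (big_cat_nat _ (n := (c * n)%N)) ?leq_addl //=; congr (_ * _).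
rewrite -[X in index_iota X _]add0n big_coprime_shift /=.
by apply: eq_bigr => i _; rewrite natrD natrM addrC.
Qed.

Lemma cprod_even c : cprod (n + c * n) = cprod (c * n) * block_even c.
Proof.
rewrite cprodD //; congr (_ * _).
rewrite (big_half nh n1) /= -big_split /= big_seq_cond [RHS]big_seq_cond.
apply: eq_bigr => j /andP[]; rewrite mem_index_iota => /andP[_ jh] _.
by rewrite natrB ?addrA //; lia.
Qed.

(** As n - h = h + 1, the added integers go from (c+1) n - h to (c+1) n + h. The part below (c+1) n
    is reflected by [big_half_rev]. *)
Lemma cprod_odd c :
  cprod (n + h.+1 + c * n) = cprod (h.+1 + c * n) * block_odd c.+1.
Proof.
rewrite /cprod (big_cat_nat _ (n := (h.+1 + c * n)%N)) //=; last by lia.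
congr (_ * _); rewrite big_coprime_shift (big_cat_nat _ (n := n)) /=; try lia.
rewrite (big_half_rev nh n1) /=.
have -> : \prod_(n <= i < n + h.+1 | coprime n i) (i + c * n)%N%:R =
          \prod_(0 <= j < h.+1 | coprime n j) (j + c.+1 * n)%N%:R :> rat.
  have := @big_coprime_shift _ _ *%R 1 0 h.+1 (fun i => (i + c * n)%:R : rat).
  rewrite !mul1n add0n [(h.+1 + n)%N]addnC => ->.
  by apply: eq_bigr => j _; rewrite mulSn addnA.
rewrite -big_split /= big_seq_cond [RHS]big_seq_cond.
apply: eq_bigr => j /andP[]; rewrite mem_index_iota => /andP[_ jh] _.
rewrite !natrD !natrM natrB; last by lia.
by rewrite -[c.+1%:R]natr1; ring.
Qed.

Lemma block_even_neq0 c : block_even c != 0.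
Proof.
apply/eqP => e; have := cprod_even c; rewrite e mulr0 => /eqP.
by rewrite (negbTE (cprod_neq0 _)).
Qed.

(** The product P(k) of the overview when m = [v n / 2], that is [m = h + u * n] for v = 2 u + 1. *)
Definition mprod (m k : nat) : rat :=
  \prod_(0 <= a < m.+1 | coprime n a) ((k%:R * n%:R + a%:R) / a%:R).

Lemma mprodE m k : mprod m k = cprod (m.+1 + k * n) / (cprod (k * n) * cprod m.+1).
Proof.
rewrite /mprod big_split /= prodfV cprodD // -/(cprod _).
have c0 := cprod_neq0 (k * n); have m0 := cprod_neq0 m.+1.
by field; rewrite m0 c0.
Qed.

Lemma mprod0 m : mprod m 0 = 1.
Proof.
apply: big1 => a ca; rewrite mul0r add0r divff //; exact: coprime_nat_neq0 ca.
Qed.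

Lemma mprodS u k : mprod (h + u * n) k.+1 =
  mprod (h + u * n) k * (block_odd (u + k).+1 / block_even k).
Proof.
rewrite !mprodE.
have -> : ((h + u * n).+1 + k.+1 * n = n + h.+1 + (u + k) * n)%N by lia.
have -> : ((h + u * n).+1 + k * n = h.+1 + (u + k) * n)%N by lia.
have -> : (k.+1 * n = n + k * n)%N by lia.
rewrite cprod_odd cprod_even.
have c0 := cprod_neq0 (k * n); have m0 := cprod_neq0 (h + u * n).+1.
have b0 := block_even_neq0 k.
by field; rewrite m0 c0 b0.
Qed.

Let s := (totient n - 2)%N.
Let beta := bernoulli_triv s n / s%:R.

(* The three corrections [1 + n^2 x] by which a pair [j] contributes to the
   quotient of blocks: from the centred block, from the block [c n, (c + 1) n],
   and from trading [{j, n - j}] for [{2 j, n - 2 j}]. *)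
Let x1 (g j : nat) : rat := - g%:R ^+ 2 * j%:R ^- 2.
Let x2 (c j : nat) : rat := - (c%:R * c.+1%:R)
  * ((c%:R * n%:R + j%:R) * (c%:R * n%:R + n%:R - j%:R))^-1.
Let x3 (j : nat) : rat := - (n%:R - 2 * j%:R) ^- 2.

Lemma half_neq0 j : coprime n j -> (j < h.+1)%N ->
  [/\ j%:R != 0 :> rat, n%:R - j%:R != 0 :> rat & n%:R - 2 * j%:R != 0 :> rat].
Proof.
move=> cj jh; split; first exact: coprime_nat_neq0 cj.
  by rewrite -natrB; [rewrite pnatr_eq0|]; lia.
by rewrite -natrM -natrB; [rewrite pnatr_eq0|]; lia.
Qed.

Lemma zlocV_blocks c j : coprime n j -> (j < h.+1)%N ->
  [/\ (c%:R * n%:R + j%:R)^-1 \in zloc n,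
      (c%:R * n%:R + n%:R - j%:R)^-1 \in zloc n
    & (n%:R - 2 * j%:R)^-1 \in zloc n].
Proof.
move=> cj jh; have n_odd := odd_of_gcdn6 n6.
have jn : (j <= n)%N by lia.
have j2n : (2 * j <= n)%N by lia.
split.
- rewrite -natrM -natrD; apply: zlocV.
  by rewrite /coprime gcdnMDl.
- rewrite -addrA -natrB // -natrM -natrD; apply: zlocV.
  by rewrite /coprime gcdnMDl -/(coprime _ _) coprime_sub.
- rewrite -natrM -natrB //; apply: zlocV.
  by rewrite coprime_sub // coprimeMr coprimen2 n_odd.
Qed.

Lemma block_neq0 c j : coprime n j -> (j < h.+1)%N ->
  c%:R * n%:R + j%:R != 0 :> rat /\ c%:R * n%:R + n%:R - j%:R != 0 :> rat.
Proof.
move=> cj jh; have j0 : (j != 0)%N by rewrite -(pnatr_eq0 rat) (coprime_nat_neq0 n1).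
split; first by rewrite -natrM -natrD pnatr_eq0; lia.
by rewrite -addrA -natrB; [rewrite -natrM -natrD pnatr_eq0|]; lia.
Qed.

(** Both decompositions compute the product of the residues prime to n, as that of j (n - j) and as
    that of 2 j (n - 2 j); the nonzero product of the j cancels. *)
Lemma prod_half_sub :
  \prod_(0 <= j < h.+1 | coprime n j) ((n%:R - j%:R) / (2 * (n%:R - 2 * j%:R))) = 1 :> rat.
Proof.
have e := big_half nh n1 *%R (fun i => i%:R : rat).
rewrite (big_half_double nh n1) /= in e.
have p0 : \prod_(0 <= j < h.+1 | coprime n j) j%:R != 0 :> rat by exact: (cprod_neq0 h.+1).
move: e; rewrite -!big_split /= => e.
have {}e : \prod_(0 <= j < h.+1 | coprime n j) (j%:R * (n%:R - j%:R)) =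
  \prod_(0 <= j < h.+1 | coprime n j) (j%:R * (2 * (n%:R - 2 * j%:R))) :> rat.
  transitivity (\prod_(0 <= j < h.+1 | coprime n j) (j%:R * (n - j)%:R : rat)).
    rewrite big_seq_cond [RHS]big_seq_cond; apply: eq_bigr => j /andP[].
    by rewrite mem_index_iota => /andP[_ jh] _; rewrite natrB //; lia.
  rewrite -e big_seq_cond [RHS]big_seq_cond; apply: eq_bigr => j /andP[].
  rewrite mem_index_iota => /andP[_ jh] _; rewrite natrB; last by lia.
  by rewrite natrM; ring.
move: e; rewrite ![\prod_(0 <= _ < _ | _) (_ * _)]big_split /= => /(mulfI p0) e.
rewrite prodfV [X in _ / X]big_split /= -e divff //.
rewrite prodf_seq_neq0; apply/allP => j; rewrite mem_index_iota => /andP[_ jh].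
by apply/implyP => cj; have [] := half_neq0 cj jh.
Qed.

Lemma block_ratio c g : 4 ^+ totient n * (block_odd g / block_even c) =
  \prod_(0 <= j < h.+1 | coprime n j) (1 + n%:R ^+ 2 * x1 g j) *
  \prod_(0 <= j < h.+1 | coprime n j) (1 + n%:R ^+ 2 * x2 c j) *
  \prod_(0 <= j < h.+1 | coprime n j) (1 + n%:R ^+ 2 * x3 j).
Proof.
rewrite (totient_half n1 nh) -mul2n exprM -prod_half_const.
pose S : rat := \prod_(0 <= j < h.+1 | coprime n j)
  ((n%:R - j%:R) / (2 * (n%:R - 2 * j%:R))).
(* Inserting this square makes the identity hold factor by factor: with D the denominator in [x2],
   the corrections are (j^2 - g^2 n^2) / j^2, j (n-j) / D and - 4 j (n-j) / (n-2j)^2. *)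
have eS : 1 = S * S by rewrite /S prod_half_sub mulr1.
rewrite -[LHS]mulr1 [X in _ * X = _]eS -prodfV -!big_split /=.
rewrite big_seq_cond [RHS]big_seq_cond.
apply: eq_bigr => j /andP[]; rewrite mem_index_iota => /andP[_ jh] cj.
have [j0 nj0 n2j0] := half_neq0 cj jh; have [b1 b2] := block_neq0 c cj jh.
rewrite /x1 /x2 /x3 -[c.+1%:R]natr1; field.
by rewrite j0 n2j0 b1 b2.
Qed.

Lemma eqmod_prod_1D (F : nat -> rat) (a : rat) :
  (forall j, coprime n j -> (j < h.+1)%N -> F j \in zloc n) ->
  eqmod n (n%:R ^+ 2) (\sum_(0 <= j < h.+1 | coprime n j) F j) (n%:R * a) ->
  eqmod n (n%:R ^+ 4) (\prod_(0 <= j < h.+1 | coprime n j) (1 + n%:R ^+ 2 * F j))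
    (1 + n%:R ^+ 3 * a).
Proof.
move=> Fn Fa; have n2 : n%:R ^+ 2 \in zloc n by rewrite rpredX ?rpred_nat.
have n4 : (n%:R ^+ 2) ^+ 2 = n%:R ^+ 4 :> rat by rewrite -exprM.
(* Membership in the range joins the predicate, because [F j] is known to be integral only for j <=
   h. *)
have := @prod_1D_eqmod n (n%:R ^+ 2) (index_iota 0 h.+1)
  (fun j => (j \in index_iota 0 h.+1) && coprime n j) F n2 _.
rewrite n4 -!big_seq_cond => /(_ _)/eqmod_trans; apply.
  by move=> j /andP[]; rewrite mem_index_iota => /andP[_ jh] cj; apply: Fn.
apply: eqmodD; first exact: eqmod_refl.
have := eqmod_scale (n%:R ^+ 2) Fa; rewrite -expr2 n4.
by rewrite [_ * (_ * a)]mulrA -exprSr.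
Qed.

Lemma eqmod_mul_1D (x y a b : rat) : a \in zloc n -> b \in zloc n ->
  eqmod n (n%:R ^+ 4) x (1 + n%:R ^+ 3 * a) ->
  eqmod n (n%:R ^+ 4) y (1 + n%:R ^+ 3 * b) ->
  eqmod n (n%:R ^+ 4) (x * y) (1 + n%:R ^+ 3 * (a + b)).
Proof.
move=> an bn [z zn ez] [w wn ew].
have nn : n%:R \in zloc n by apply: rpred_nat.
have cn c i : c \in zloc n -> 1 + n%:R ^+ i * c \in zloc n.
  by move=> c_n; apply: rpredD; [apply: rpred1 | apply: rpredM => //; apply: rpredX].
have yE : y = 1 + n%:R ^+ 3 * b + n%:R ^+ 4 * w by rewrite -ew; ring.
have yn : y \in zloc n.
  by rewrite yE; apply: rpredD; [apply: cn | apply: rpredM => //; apply: rpredX].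
exists (n%:R ^+ 2 * (a * b) + z * y + (1 + n%:R ^+ 3 * a) * w).
  apply: rpredD; last by apply: rpredM => //; apply: cn.
  apply: rpredD; last exact: rpredM.
  by apply: rpredM; [apply: rpredX | apply: rpredM].
have xE : x = 1 + n%:R ^+ 3 * a + n%:R ^+ 4 * z by rewrite -ez; ring.
by rewrite xE yE; ring.
Qed.

Lemma sum_x1 g : eqmod n (n%:R ^+ 2) (\sum_(0 <= j < h.+1 | coprime n j) x1 g j)
  (n%:R * (7 * g%:R ^+ 2 * beta)).
Proof.
rewrite -mulr_sumr -/(Hsum n h 2).
have gn : - g%:R ^+ 2 \in zloc n by rewrite rpredN rpredX ?rpred_nat.
have := eqmodMl gn (Hsum2_beta n6 n1 nh); rewrite -/s -/beta.
by congr (eqmod _ _ _ _); move: beta => b; ring.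
Qed.

(** The denominator is c (c+1) n^2 + j (n-j), so modulo n^2 its inverse is the term of [Esum]. *)
Lemma sum_x2 c : eqmod n (n%:R ^+ 2) (\sum_(0 <= j < h.+1 | coprime n j) x2 c j)
  (n%:R * (- (c%:R * c.+1%:R) * beta)).
Proof.
rewrite -mulr_sumr [X in eqmod _ _ _ X]mulrCA.
apply: eqmodMl; first by rewrite rpredN rpredM ?rpred_nat.
apply: eqmod_trans (Esum_beta n6 n1 nh).
rewrite /Esum big_seq_cond [X in eqmod _ _ _ X]big_seq_cond.
apply: eqmod_sum => j /andP[]; rewrite mem_index_iota => /andP[_ jh] cj.
have [j0 nj0 n2j0] := half_neq0 cj jh; have [b1 b2] := block_neq0 c cj jh.
have [v1 v2 _] := zlocV_blocks c cj jh; have [_ v3 _] := zlocV_blocks 0 cj jh.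
rewrite mul0r add0r in v3.
exists (- (c%:R * c.+1%:R) * ((c%:R * n%:R + j%:R)^-1 * (c%:R * n%:R + n%:R - j%:R)^-1)
   * (j%:R^-1 * (n%:R - j%:R)^-1)).
  apply: rpredM; last by apply: rpredM => //; apply: zlocV.
  by apply: rpredM; [rewrite rpredN rpredM ?rpred_nat | apply: rpredM].
by rewrite -[c.+1%:R]natr1; field; rewrite j0 nj0 b1 b2.
Qed.

(** Since (n - 2 j)^2 = n^2 - 4 j (n - j), modulo n^2 the term [x3 j] is a quarter of the term of
    [Esum]. *)
Lemma sum_x3 : eqmod n (n%:R ^+ 2) (\sum_(0 <= j < h.+1 | coprime n j) x3 j)
  (n%:R * (4^-1 * beta)).
Proof.
have v4 : 4^-1 \in zloc n.
  by apply: (@zlocV n (2 * 2)); rewrite coprimeMr coprimen2 odd_of_gcdn6.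
rewrite mulrCA.
apply: eqmod_trans (eqmodMl v4 (Esum_beta n6 n1 nh)).
rewrite /Esum mulr_sumr big_seq_cond [X in eqmod _ _ _ X]big_seq_cond.
apply: eqmod_sum => j /andP[]; rewrite mem_index_iota => /andP[_ jh] cj.
have [j0 nj0 n2j0] := half_neq0 cj jh.
have [_ v3 v2] := zlocV_blocks 0 cj jh; rewrite mul0r add0r in v3.
exists (- 4^-1 * (j%:R^-1 * (n%:R - j%:R)^-1) * (n%:R - 2 * j%:R)^-1 ^+ 2).
  apply: rpredM; last exact: rpredX.
  apply: rpredM; first by rewrite rpredN.
  by apply: rpredM => //; apply: zlocV.
by rewrite /x3; field; rewrite j0 nj0 n2j0.
Qed.

Lemma zloc_beta : beta \in zloc n.
Proof. by have [] := beta_half n6 n1 nh. Qed.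

Lemma block_ratio_eqmod c g :
  eqmod n (n%:R ^+ 4) (4 ^+ totient n * (block_odd g / block_even c))
  (1 + n%:R ^+ 3 * (7 * g%:R ^+ 2 * beta + - (c%:R * c.+1%:R) * beta + 4^-1 * beta)).
Proof.
have bn := zloc_beta.
have v4 : 4^-1 \in zloc n.
  by apply: (@zlocV n (2 * 2)); rewrite coprimeMr coprimen2 odd_of_gcdn6.
have e1 : 7 * g%:R ^+ 2 * beta \in zloc n.
  by apply: rpredM => //; rewrite -natrX -natrM rpred_nat.
have e2 : - (c%:R * c.+1%:R) * beta \in zloc n.
  by apply: rpredM => //; rewrite rpredN -natrM rpred_nat.
rewrite block_ratio; apply: eqmod_mul_1D.
- exact: rpredD.
- exact: rpredM.
- apply: eqmod_mul_1D => //; apply: eqmod_prod_1D.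
  + move=> j cj _; apply: rpredM; first by rewrite rpredN rpredX ?rpred_nat.
    by rewrite -exprVn rpredX // zlocV.
  + exact: sum_x1.
  + move=> j cj jh; have [v1 v2 _] := zlocV_blocks c cj jh.
    apply: rpredM; first by rewrite rpredN rpredM ?rpred_nat.
    by rewrite invfM rpredM.
  + exact: sum_x2.
- apply: eqmod_prod_1D; last exact: sum_x3.
  move=> j cj jh; have [_ _ v2] := zlocV_blocks 0 cj jh.
  by rewrite rpredN -exprVn rpredX.
Qed.

(** The coefficients of [block_ratio_eqmod] telescope: 7 (u+k+1)^2 - k (k+1) + 1/4 is the increment
    of k (7 v^2 + 14 k v + 8 k^2) / 4 from k to k + 1, with v = 2 u + 1. *)
Lemma mprod_eqmod u k :
  eqmod n (n%:R ^+ 4) (4 ^+ (k * totient n) * mprod (h + u * n) k)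
  (1 + n%:R ^+ 3 * ((k * (7 * u.*2.+1 ^ 2 + 14 * k * u.*2.+1 + 8 * k ^ 2))%N%:R / 4 * beta)).
Proof.
have bn := zloc_beta.
have v4 : 4^-1 \in zloc n.
  by apply: (@zlocV n (2 * 2)); rewrite coprimeMr coprimen2 odd_of_gcdn6.
elim: k => [|k IH].
  by rewrite mul0n expr0 mprod0 mul0n !mul0r mulr0 mulr1 addr0; apply: eqmod_refl.
have an : (k * (7 * u.*2.+1 ^ 2 + 14 * k * u.*2.+1 + 8 * k ^ 2))%N%:R / 4 * beta \in zloc n.
  by apply: rpredM => //; apply: rpredM => //; apply: rpred_nat.
have bkn : 7 * (u + k).+1%:R ^+ 2 * beta + - (k%:R * k.+1%:R) * beta + 4^-1 * beta \in zloc n.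
  apply: rpredD; last exact: rpredM.
  apply: rpredD; apply: rpredM => //; first by rewrite -natrX -natrM rpred_nat.
  by rewrite rpredN -natrM rpred_nat.
have := eqmod_mul_1D an bkn IH (block_ratio_eqmod k (u + k).+1).
rewrite mprodS mulSn exprD.
have -> (a b c d : rat) : a * c * (b * d) = b * a * (c * d) by ring.
congr (eqmod _ _ _ (1 + _ * _)).
rewrite -muln2 !(natrM, natrD, natrX, mulrS); move: beta => b; by field.
Qed.

End Blocks.

(** * Division by 4^(k phi(n)) and the congruence modulo n^4 *)

Theorem theorem3p4 (n k v : nat)
  (hn : (1 < n)%N) (hn6 : gcdn n 6 = 1%N) (hk : (0 < k)%N)
  (hv : (0 < v)%N) (hvodd : odd v) :
  ratcong (n ^ 4)
    (\prod_(d <- divisors n)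
       ('C(k * d + (v * d) %/ 2, (v * d - 1) %/ 2)%:R : rat)
         ^ moebius (n %/ d))
    (4%:R ^- (k * totient n)
     + (k * (7 * v ^ 2 + 14 * k * v + 8 * k ^ 2))%N%:R / 4%:R
       * n%:R ^+ 3
       * (bernoulli_triv (totient n - 2) n / (totient n - 2)%N%:R)).
Proof.
have n_odd := odd_of_gcdn6 hn6.
have [h nh] : exists h, n = h.*2.+1.
  by exists n./2; rewrite -[LHS]odd_double_half n_odd.
have [u vu] : exists u, v = u.*2.+1.
  by exists v./2; rewrite -[LHS]odd_double_half hvodd.
have n0 : n%:R != 0 :> rat by rewrite pnatr_eq0 -lt0n ltnW.
rewrite moebius_bin_prod //; last exact: ltnW.
have -> : ((v * n) %/ 2 = h + u * n)%N by rewrite vu nh; lia.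
rewrite (eq_bigl (coprime n)); last first.
  move=> a /=; case: posnP => [->|]; rewrite ?andbT // andbF.
  by rewrite /coprime gcdn0 gtn_eqF.
rewrite natrM -/(mprod n (h + u * n) k).
have := mprod_eqmod hn6 hn nh u k; rewrite -vu.
have := zloc_beta hn6 hn nh.
set beta := bernoulli_triv _ _ / _; set X := (k * _)%:R => bn [z zn ez].
have v4 i : 4 ^- i \in zloc n.
  rewrite -exprVn rpredX //.
  by apply: (@zlocV n (2 * 2)); rewrite coprimeMr coprimen2 n_odd.
(* Euler's theorem in base 4^k: dividing by 4^(k phi(n)) alters the n^3 term only by a multiple of
   n^4, so that term keeps its coefficient. *)
have [w wn ew] : eqmod n n%:R (4 ^+ (k * totient n)) 1.
  have := @euler_eqmod n (4 ^ k)%N.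
  rewrite natrX -exprM expn_gt0; apply => //.
  by rewrite coprimeXr // (@coprimeMr n 2 2) coprimen2 n_odd.
set M := mprod _ _ _ in ez *; set e := (k * totient n)%N in ez ew *.
have q0 : 4 ^+ e != 0 :> rat by rewrite expf_neq0.
rewrite /ratcong coprimezE /= coprimeXr // natrX.
have -> : (M - (4 ^- e + X / 4 * n%:R ^+ 3 * beta)) / n%:R ^+ 4 =
    4 ^- e * z - 4 ^- e * w * (X / 4 * beta).
  apply: (mulIf (expf_neq0 4 n0)); rewrite mulfVK ?expf_neq0 //.
  apply: (mulfI q0).
  transitivity (n%:R ^+ 4 * z - n%:R ^+ 3 * (n%:R * w) * (X / 4 * beta)).
    by rewrite -ez -ew; field.
  by field.
change (4 ^- e * z - 4 ^- e * w * (X / 4 * beta) \in zloc n).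
apply: rpredB; apply: rpredM => //; first exact: rpredM.
apply: rpredM => //; apply: rpredM; first exact: rpred_nat.
exact: (v4 1%N).
Qed.
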